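(* Let $R$ be a finite commutative ring with identity $1\neq 0$ such that $\Gamma(R)\neq\overline{\Gamma}(R)$. If $\mathrm{Nil}(R)=\{0,a\}$ for some $a\in R\setminus\{0\}$, then $\overline{\Gamma}(R)$ is complemented.
   Context: $Z(R)$ is the set of zero-divisors of $R$ (including $0$), $Z(R)^*=Z(R)\setminus\{0\}$, and $\mathrm{Nil}(R)$ is the set of nilpotent elements of $R$ (including $0$). The zero-divisor graph $\Gamma(R)$ is the simple graph with vertex set $Z(R)^*$ in which two distinct vertices $x,y$ are adjacent if and only if $xy=0$. The extended zero-divisor graph $\overline{\Gamma}(R)$ is the simple graph with the same vertex set $Z(R)^*$ in which two distinct vertices $x,y$ are adjacent if and only if there exist positive integers $n,m$ with $x^ny^m=0$, $x^n\neq 0$ and $y^m\neq 0$. In a simple graph $G$, two vertices $u,v$ are orthogonal, written $u\perp v$, if they are adjacent and no vertex is adjacent to both of them. $G$ is complemented if for every vertex $v$ there is a vertex $u$ with $v\perp u$. *)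

(* Defs.v *)
From mathcomp Require Import all_boot all_algebra.
From mathcomp Require Import boolp classical_sets.

Set Implicit Arguments.
Unset Strict Implicit.
Unset Printing Implicit Defensive.

Import GRing.Theory.

Local Open Scope classical_set_scope.
Local Open Scope ring_scope.

Record sgraph (T : Type) := SGraph {
  vertices : set T;
  adj : T -> T -> Prop;
  adj_vertex : forall x y, adj x y -> vertices x;
  adj_sym : forall x y, adj x y -> adj y x;
  adj_irrefl : forall x, ~ adj x x
}.

(* Equality of graphs is thus equality of vertex sets and of edge relations. *)
Lemma sgraphP (T : Type) (G H : sgraph T) :
  G = H <->
  vertices G = vertices H /\ (forall x y, adj G x y <-> adj H x y).
Proof.
split=> [-> //|[]].
case: G => V E vE sE iE; case: H => W F vF sF iF /= VW EF.
have EFeq : E = F by apply/funext=> x; apply/funext=> y; apply/propext.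
subst W F; congr SGraph; exact: Prop_irrelevance.
Qed.

Definition orthogonal (T : Type) (G : sgraph T) (u v : T) : Prop :=
  adj G u v /\ ~ (exists w, adj G w u /\ adj G w v).

Definition complemented (T : Type) (G : sgraph T) : Prop :=
  forall v, vertices G v -> exists u, vertices G u /\ orthogonal G v u.

Definition zero_divisors (R : comNzRingType) : set R :=
  [set x | exists y, y != 0 /\ x * y = 0].
Arguments zero_divisors : clear implicits.

Definition nonzero_zero_divisors (R : comNzRingType) : set R :=
  zero_divisors R `\ 0.
Arguments nonzero_zero_divisors : clear implicits.

Definition nilpotents (R : comNzRingType) : set R :=
  [set x | exists n : nat, (0 < n)%N /\ x ^+ n = 0].
Arguments nilpotents : clear implicits.

Definition zdg_adj (R : comNzRingType) (x y : R) : Prop :=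
  [/\ nonzero_zero_divisors R x, nonzero_zero_divisors R y, x <> y
    & x * y = 0].

Definition ezdg_adj (R : comNzRingType) (x y : R) : Prop :=
  [/\ nonzero_zero_divisors R x, nonzero_zero_divisors R y, x <> y
    & exists n m : nat,
        [/\ (0 < n)%N, (0 < m)%N, x ^+ n * y ^+ m = 0, x ^+ n != 0
          & y ^+ m != 0]].

Lemma zdg_adj_vertex (R : comNzRingType) (x y : R) :
  zdg_adj x y -> nonzero_zero_divisors R x.
Proof. by case. Qed.

Lemma zdg_adj_sym (R : comNzRingType) (x y : R) : zdg_adj x y -> zdg_adj y x.
Proof. by case=> hx hy /nesym xy e; split=> //; rewrite mulrC. Qed.

Lemma zdg_adj_irrefl (R : comNzRingType) (x : R) : ~ zdg_adj x x.
Proof. by case. Qed.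

Definition zero_divisor_graph (R : comNzRingType) : sgraph R :=
  SGraph (@zdg_adj_vertex R) (@zdg_adj_sym R) (@zdg_adj_irrefl R).

Lemma ezdg_adj_vertex (R : comNzRingType) (x y : R) :
  ezdg_adj x y -> nonzero_zero_divisors R x.
Proof. by case. Qed.

Lemma ezdg_adj_sym (R : comNzRingType) (x y : R) :
  ezdg_adj x y -> ezdg_adj y x.
Proof.
case=> hx hy /nesym xy [n [m [n0 m0 e xn ym]]]; split=> //.
by exists m, n; split=> //; rewrite mulrC.
Qed.

Lemma ezdg_adj_irrefl (R : comNzRingType) (x : R) : ~ ezdg_adj x x.
Proof. by case. Qed.

Definition extended_zero_divisor_graph (R : comNzRingType) : sgraph R :=
  SGraph (@ezdg_adj_vertex R) (@ezdg_adj_sym R) (@ezdg_adj_irrefl R).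

(* Main.v *)
Require Import Defs.
From mathcomp Require Import all_boot all_algebra.
From mathcomp Require Import boolp classical_sets.

(** In a finite ring every [v] has a positive power [e] that is idempotent, and
    [e = 0] exactly when [v] is nilpotent.  If [e <> 0] then [1 - e] is
    orthogonal to [v]: a common neighbour would be nilpotent, hence equal to
    [a], and killed by both [e] and [1 - e].  The only nilpotent vertex is [a].
    Its multiples are nilpotent, so [a * e] is [0] or [a] for each idempotent
    [e]; since the two graphs differ there is a vertex other than [a], whose
    idempotent power [g] is nontrivial, and [a] is killed by [g] or [1 - g].
    Among the idempotents killing [a], one whose ideal [eR] has maximal size is
    orthogonal to [a]: if [f] is the idempotent power of a common neighbour,
    then [e f = 0] and [e + f] generates a larger ideal. *)

Set Implicit Arguments.
Unset Strict Implicit.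
Unset Printing Implicit Defensive.

Import GRing.Theory.

Local Open Scope classical_set_scope.
Local Open Scope ring_scope.

(** By pigeonhole the powers of [x] are eventually periodic, with preperiod [i] and period [p]; any
    multiple [N >= i] of [p] then gives [x ^+ (N + N) = x ^+ N]. *)
Lemma idempotent_power (R : finNzRingType) (x : R) :
  exists2 N : nat, (0 < N)%N & x ^+ N * x ^+ N = x ^+ N.
Proof.
have [i [p p0 xip]] : exists i, exists2 p, (0 < p)%N & x ^+ (i + p) = x ^+ i.
  have /injectivePn[i [j ij xij]] :
      ~~ injectiveb (fun i : 'I_(#|R|.+1) => x ^+ i).
    by apply/negP => /injectiveP/leq_card; rewrite card_ord ltnn.
  move: ij; rewrite neq_ltn => /orP[] ij.
  - by exists i, (j - i)%N; rewrite ?subn_gt0 // subnKC 1?ltnW.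
  - by exists j, (i - j)%N; rewrite ?subn_gt0 // subnKC 1?ltnW.
have periodic k t : (i <= k)%N -> x ^+ (k + t * p) = x ^+ k.
  move=> ik; elim: t => [|t IH]; first by rewrite mul0n addn0.
  by rewrite mulSn addnA -{1}(subnK ik) -!addnA exprD addnA exprD xip -exprD
             -exprD addnA subnK.
(* The successor keeps the exponent positive when [i = 0]. *)
exists (i.+1 * p)%N; first by rewrite muln_gt0.
by rewrite -exprD periodic // (leq_trans (leqnSn i)) // leq_pmulr.
Qed.

Lemma idempotentX (R : nzRingType) (e : R) (n : nat) :
  e * e = e -> (0 < n)%N -> e ^+ n = e.
Proof.
by move=> ee; case: n => // n _; elim: n => [|n IH]; rewrite ?expr1 // exprS IH.
Qed.

(** Idempotence gives [x ^+ N = (x ^+ m) ^+ N], from which a factor [x ^+ m] splits off. This frees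
    edge relations from their arbitrary exponents. *)
Lemma mulr_idempotent_power (R : comNzRingType) (x y : R) (N m : nat) :
  (0 < N)%N -> x ^+ N * x ^+ N = x ^+ N -> (0 < m)%N -> y * x ^+ m = 0 ->
  y * x ^+ N = 0.
Proof.
move=> N0 idem m0 yx; rewrite -(idempotentX idem m0) -exprM mulnC exprM.
by rewrite -(prednK N0) exprS mulrA yx mul0r.
Qed.

Lemma idempotent_compl (R : nzRingType) (e : R) :
  e * e = e -> (1 - e) * (1 - e) = 1 - e.
Proof. by move=> ee; rewrite mulrBr mulr1 mulrBl mul1r ee subrr subr0. Qed.

Lemma expr_neq0_nonnilpotent (R : comNzRingType) (a x : R) (N : nat) :
  nilpotents R = [set 0; a] -> (0 < N)%N -> x != 0 -> x <> a -> x ^+ N != 0.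
Proof.
move=> hNil N0 x0 xa; apply/eqP => xN.
have : nilpotents R x by exists N.
by rewrite hNil => -[/= xz|//]; rewrite xz eqxx in x0.
Qed.

Lemma nilpotent_mull (R : comNzRingType) (a : R) :
  nilpotents R a -> forall x, nilpotents R (a * x).
Proof. by move=> [n [n0 an]] x; exists n; rewrite exprMn an mul0r. Qed.

Lemma nilpotentX (R : comNzRingType) (a : R) (n : nat) :
  nilpotents R = [set 0; a] -> (0 < n)%N -> a ^+ n != 0 -> a ^+ n = a.
Proof.
move=> hNil n0 an; have : nilpotents R (a ^+ n).
  by rewrite -(prednK n0) exprS; apply: nilpotent_mull; rewrite hNil; right.
by rewrite hNil => -[/= an0|//]; rewrite an0 eqxx in an.
Qed.

Lemma compl_idempotent_orthogonal (R : comNzRingType) (a v : R) (N : nat) :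
  nilpotents R = [set 0; a] -> nonzero_zero_divisors R v -> v <> a ->
  (0 < N)%N -> v ^+ N * v ^+ N = v ^+ N ->
  Defs.orthogonal (extended_zero_divisor_graph R) v (1 - v ^+ N).
Proof.
move=> hNil vV va N0; set e := v ^+ N => ee.
have [[w [w0 vw]] /eqP v0] := vV.
have e0 : e != 0 := expr_neq0_nonnilpotent hNil N0 v0 va.
have ec : e * (1 - e) = 0 by rewrite mulrBr mulr1 ee subrr.
have we : w * e = 0.
  by apply: (mulr_idempotent_power N0 ee (m := 1)); rewrite // expr1 mulrC.
have c0 : 1 - e != 0.
  apply/eqP => /subr0_eq e1; move: we; rewrite -e1 mulr1 => /eqP.
  by rewrite (negbTE w0).
split.
- split=> //.
  + by split; [exists e; rewrite mulrC | apply/eqP].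
  (* If [v = 1 - e], then [e * v = 0], so [e] kills its own power-of-[v] form. *)
  + move=> vc; have : e * e = 0.
      rewrite {2}/e (mulr_idempotent_power N0 ee (m := 1)) // expr1.
      by rewrite vc.
    by rewrite ee => /eqP; rewrite (negbTE e0).
  + by exists N, 1%N; rewrite expr1.
- case=> x [[xV _ _ [n [m [n0 m0 xv xn _]]]] [_ _ _ [k [l [k0 l0 xc xk _]]]]].
  have xe : x ^+ n * e = 0 := mulr_idempotent_power N0 ee m0 xv.
  rewrite (idempotentX (idempotent_compl ee) l0) in xc.
  (* Split [1] as [(1 - e) + e]: [x ^+ k] kills the first summand and [x ^+ n] the second. *)
  have xnk : x ^+ (n + k) = 0.
    rewrite -[x ^+ _]mulr1 -(subrK e 1) mulrDr exprD.
    by rewrite -mulrA xc mulr0 add0r mulrAC xe mul0r.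
  have xa : x = a.
    have : nilpotents R x by exists (n + k)%N; rewrite addn_gt0 n0.
    by rewrite hNil => -[/= x0|//]; case: xV => _; rewrite /= x0.
  move: xn xk xe xc; rewrite xa => an ak.
  rewrite (nilpotentX hNil n0 an) (nilpotentX hNil k0 ak) => ae.
  by rewrite mulrBr mulr1 ae subr0 => a0; rewrite -xa in a0; case: xV.
Qed.

Lemma idempotent_annihilator (R : finComNzRingType) (a v : R) :
  nilpotents R = [set 0; a] -> nonzero_zero_divisors R v -> v <> a ->
  exists e, [/\ e * e = e, e != 0 & a * e = 0].
Proof.
move=> hNil [[w [w0 vw]] /eqP v0] va.
have [N N0 ee] := idempotent_power v; set e := v ^+ N in ee.
have e0 : e != 0 := expr_neq0_nonnilpotent hNil N0 v0 va.
have na : nilpotents R a by rewrite hNil; right.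
have := nilpotent_mull na e; rewrite hNil => -[/= ae|/= ae]; first by exists e.
exists (1 - e); split; first exact: idempotent_compl.
(* If [e = 1], the zero-divisor [v] would be a unit, contradicting [v * w = 0]. *)
- apply/eqP => /subr0_eq e1.
  have : w * e = 0.
    by apply: (mulr_idempotent_power N0 ee (m := 1)); rewrite // expr1 mulrC.
  by rewrite -e1 mulr1 => /eqP; rewrite (negbTE w0).
- by rewrite mulrBr mulr1 ae subrr.
Qed.

Lemma nilpotent_orthogonal (R : finComNzRingType) (a e0 : R) :
  nilpotents R = [set 0; a] -> a != 0 ->
  e0 * e0 = e0 -> e0 != 0 -> a * e0 = 0 ->
  exists e, nonzero_zero_divisors R e /\
    Defs.orthogonal (extended_zero_divisor_graph R) a e.
Proof.
move=> hNil a0 e00 e0n ae0.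
pose P e := [&& e * e == e, e != 0 & a * e == 0 :> R].
have Pe0 : P e0 by rewrite /P e00 ae0 e0n !eqxx.
(* For idempotent [e], the fixed points of multiplication by [e] form the ideal [eR]. *)
case: (@arg_maxnP _ e0 P (fun e => #|[set y : R | y * e == y]%SET|) Pe0).
move=> e /and3P[/eqP ee en /eqP ae] emax.
have eV : nonzero_zero_divisors R e.
  by split; [exists a; rewrite mulrC | apply/eqP].
have aV : nonzero_zero_divisors R a by split; [exists e | apply/eqP].
exists e; split=> //; split.
- split=> //; last by exists 1%N, 1%N; rewrite !expr1.
  by move=> eqae; rewrite eqae ee in ae; rewrite ae eqxx in en.
- case=> x [[[_ /eqP x0] _ xa [n [m [n0 m0 xna _ am]]]]].
  move=> [_ _ _ [k [l [k0 l0 xke _ _]]]].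
  have ama := nilpotentX hNil m0 am.
  have [N N0 ff] := idempotent_power x; set f := x ^+ N in ff.
  have f0 : f != 0 := expr_neq0_nonnilpotent hNil N0 x0 xa.
  have af : a * f = 0.
    by apply: (mulr_idempotent_power N0 ff n0); rewrite mulrC -ama.
  have ef : e * f = 0.
    apply: (mulr_idempotent_power N0 ff k0).
    by rewrite mulrC -(idempotentX ee l0).
  have eef : e * (e + f) = e by rewrite mulrDr ee ef addr0.
  have fef : f * (e + f) = f by rewrite mulrDr ff mulrC ef add0r.
  have Pef : P (e + f).
    rewrite /P mulrDl eef fef eqxx mulrDr ae af addr0 eqxx andbT /=.
    by apply/eqP => efz; case/eqP: f0; rewrite -fef efz mulr0.
  have := emax _ Pef; rewrite /= leqNgt => /negP; apply.
  (* The inclusion is strict because of [f]: it is fixed by [e + f], while [f * e = 0] and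
     [f != 0]. *)
  apply: proper_card; apply/properP; split.
  + apply/fintype.subsetP => y; rewrite !inE => /eqP ye.
    by rewrite -{1}ye -mulrA eef ye.
  + exists f; rewrite inE; first by rewrite fef.
    by rewrite mulrC ef eq_sym.
Qed.

Theorem corollary2p8 (R : finComNzRingType)
  (hR : zero_divisor_graph R <> extended_zero_divisor_graph R)
  (a : R) (a_neq0 : a != 0) (hNil : nilpotents R = [set 0; a]) :
  complemented (extended_zero_divisor_graph R).
Proof.
have [v0 [v0V v0a]] : exists v, nonzero_zero_divisors R v /\ v <> a.
  (* With [a] as the only possible vertex, both graphs are edgeless and hence equal. *)
  apply: contrapT => none; apply: hR; apply/sgraphP; split=> // x y.
  have VE z : nonzero_zero_divisors R z -> z = a.
    by move=> zV; apply: contrapT => za; apply: none; exists z.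
  by split=> -[/VE -> /VE ->].
have [e0 [e00 e0n ae0]] := idempotent_annihilator hNil v0V v0a.
move=> v vV; have [va|va] := pselect (v = a).
  by rewrite va; exact: (nilpotent_orthogonal hNil a_neq0 e00 e0n ae0).
have [N N0 ee] := idempotent_power v.
exists (1 - v ^+ N).
have orth := compl_idempotent_orthogonal hNil vV va N0 ee.
by split=> //; case: orth => -[].
Qed.
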